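(* Let $\mathcal{C}=\{c_j\}_{j=1}^L$ be an extremal set of constraints on $\mathcal{X}=\{0,1\}^n$, let $\theta\in\mathbb{R}^n$, and assume $q_\emptyset>0$. Then the expected total number of constraint re-samplings performed throughout the sampling algorithm described in the context equals $$\frac{1}{q_\emptyset}\sum_{j=1}^L q_{\{c_j\}} .$$
   Context: Constraints: each constraint $c_j$ is a function $c_j:\mathcal{X}=\{0,1\}^n\to\{0,1\}$ whose value depends only on the variables in a subset $\mathrm{var}(c_j)\subseteq\{X_1,\dots,X_n\}$; $c_j(x)=1$ means $x$ satisfies $c_j$, and $c_j(x)=0$ means $x$ violates $c_j$. Extremal: $\mathcal{C}$ is called extremal if for each pair of (distinct) constraints $c_i,c_j\in\mathcal{C}$, either $\mathrm{var}(c_i)\cap\mathrm{var}(c_j)=\emptyset$, or for all $x\in\mathcal{X}$ one has $c_i(x)=1$ or $c_j(x)=1$. Sampling algorithm: draw an initial assignment $X_1$ (the round-1 assignment) with independent coordinates, the $i$-th coordinate taking value $x_i\in\{0,1\}$ with probability $\exp(\theta_i x_i)/(1+\exp(\theta_i))$. At round $t\ge1$, let $S_t\subseteq\mathcal{C}$ be the set of all constraints violated by the current assignment. If $S_t=\emptyset$, stop and output the current assignment. Otherwise redraw, independently of everything before and of each other, all coordinates in $\mathrm{var}(S_t)=\bigcup_{c\in S_t}\mathrm{var}(c)$ from the same marginal distributions, keep all other coordinates, and pass to round $t+1$. Number of re-samplings: constraint $c_j$ is re-sampled once at each round $t$ with $c_j\in S_t$; $T_j$ denotes the number of such rounds, and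 the total number of constraint re-samplings is $\sum_{j=1}^L T_j=\sum_t |S_t|$. Probabilities: for $S\subseteq\mathcal{C}$, $q_S$ is the probability, under the product distribution of the initial assignment, that all constraints in $S$ are violated and all constraints in $\mathcal{C}\setminus S$ are satisfied. Thus $q_\emptyset$ is the probability that all constraints are satisfied, and $q_{\{c_j\}}$ is the probability that $c_j$ is the only violated constraint. *)

(* Defs.v *)
From mathcomp Require Import all_boot all_order all_algebra.
From mathcomp Require Import all_classical all_reals all_analysis.

Set Implicit Arguments.
Unset Strict Implicit.
Unset Printing Implicit Defensive.

Import Order.TTheory GRing.Theory Num.Theory.
Local Open Scope classical_set_scope.
Local Open Scope ring_scope.

Definition assignment (n : nat) := {ffun 'I_n -> bool}.

(* [vars] is any set of variables the value depends on, not necessarily the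
   smallest one: it is part of the data, since it governs what is redrawn. *)
Record constraint (n : nat) := Constraint {
  vars : {set 'I_n};
  sat : assignment n -> bool;
  sat_vars : forall x y : assignment n,
    (forall i, i \in vars -> x i = y i) -> sat x = sat y }.

Section Constraints.
Variables (n L : nat) (C : 'I_L -> constraint n).

Definition extremal : Prop :=
  forall i j : 'I_L, i != j ->
    (vars (C i) :&: vars (C j) = finset.set0)%SET \/
    (forall x : assignment n, sat (C i) x \/ sat (C j) x).

Definition violated (x : assignment n) : {set 'I_L} :=
  [set j | ~~ sat (C j) x]%SET.

Definition vars_of (S : {set 'I_L}) : {set 'I_n} :=
  (\bigcup_(j in S) vars (C j))%SET.

(* One round: [u] supplies the fresh values. If no constraint is violated then
   nothing is redrawn, so a run that has stopped stays at its output. *)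
Definition resample (u x : assignment n) : assignment n :=
  [ffun i => if i \in vars_of (violated x) then u i else x i].

(* Rounds are numbered from 0. *)
Fixpoint current (u : nat -> assignment n) (t : nat) : assignment n :=
  if t is t'.+1 then resample (u t) (current u t') else u 0%N.

(* May be +oo; rounds after stopping contribute nothing, as [violated] is then
   empty. *)
Definition num_resamplings (R : realType) (u : nat -> assignment n) (j : 'I_L)
    : \bar R :=
  (\sum_(0 <= t <oo) ((j \in violated (current u t))%:R : R)%:E)%E.

End Constraints.

Section Product.
Variables (R : realType) (n : nat) (theta : 'I_n -> R).

Definition marginal (i : 'I_n) (b : bool) : R :=
  expR (theta i * b%:R) / (1 + expR (theta i)).

Definition product_mass (x : assignment n) : R := \prod_i marginal i (x i).

Definition q (L : nat) (C : 'I_L -> constraint n) (S : {set 'I_L}) : R :=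
  \sum_(x : assignment n | violated C x == S) product_mass x.

End Product.

Definition mutually_independent (d d' : measure_display) (T : measurableType d)
    (T' : measurableType d') (R : realType) (P : probability T R)
    (I : eqType) (X : I -> {RV P >-> T'}) : Prop :=
  forall (s : seq I) (A : I -> set T'),
    uniq s -> (forall i, i \in s -> measurable (A i)) ->
    P (\bigcap_(i in [set` s]) X i @^-1` A i)
    = (\prod_(i <- s) P (X i @^-1` A i))%E.

Section Run.
Variables (d : measure_display) (T : measurableType d) (R : realType).
Variables (P : probability T R) (n : nat).

(* [U t i] is the value coordinate [i] takes if it is drawn at round [t]; the
   values that are not needed are simply not looked at. *)
Definition fresh_draws (theta : 'I_n -> R)
    (U : nat -> 'I_n -> {RV P >-> bool}) : Prop :=
  mutually_independent (fun k : nat * 'I_n => U k.1 k.2) /\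
  (forall t i b, P (U t i @^-1` [set b]) = (marginal theta i b)%:E).

Definition draw (U : nat -> 'I_n -> {RV P >-> bool}) (w : T) (t : nat)
    : assignment n :=
  [ffun i => U t i w].

End Run.

(* Main.v *)
(* Write p_S for the probability that all constraints in S are violated, and
   N(S) for S together with the constraints sharing a variable with S. For
   extremal constraints, S is the violated set iff S is violated and everything
   outside N(S) is satisfied, two independent events, and redrawing
   var(S) leaves an assignment distributed as the initial one conditioned on
   satisfying everything outside N(S). Hence, given the violated sets of
   rounds 0..t, the current assignment is always a conditioned initial one,
   and everything reduces to a chain on violated sets. With
   Z(W) = P(all violated constraints lie in W), the expected number of
   resamplings starting from the initial law conditioned on that event is
   G(W)/Z(W),
     G(W) = c Z(W) - sum_(j notin W) P(j is the only violation outside W),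
   where c is the claimed value; this comes from taking the logarithmic
   derivative in the p_j of the generating function Z(W)/q_0 of the heaps of
   pieces with minimal pieces in W. One checks
   G(W) = sum_(S included in W) (q_S |S| + p_S G(N(S))) directly, so the partial
   sums of the expectation telescope; the remainder is at most a constant times
   the current expected number of violations, hence tends to 0 because the
   partial sums are bounded. *)
Require Import Defs.
From mathcomp Require Import all_boot all_order all_algebra.
From mathcomp Require Import all_classical all_reals all_analysis.
From mathcomp Require Import measurable_realfun ring lra.

Set Implicit Arguments.
Unset Strict Implicit.
Unset Printing Implicit Defensive.

Import Order.TTheory GRing.Theory Num.Theory.
Local Open Scope ring_scope.

(** * Product law and exchange of coordinates *)

Definition splice {n} (V : {set 'I_n}) (u x : assignment n) : assignment n :=
  [ffun i => if i \in V then u i else x i].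

Section ProductMass.
Variables (R : realType) (n : nat) (theta : 'I_n -> R).
Local Notation mu := (product_mass theta).

Lemma marginal_ge0 i b : 0 <= marginal theta i b.
Proof. by rewrite /marginal divr_ge0 ?addr_ge0 ?expR_ge0. Qed.

Lemma sum_marginal i : \sum_b marginal theta i b = 1.
Proof.
rewrite big_bool /marginal /= mulr1 mulr0 expR0 -mulrDl addrC divff //.
Qed.

Lemma product_mass_ge0 x : 0 <= mu x.
Proof. by apply: prodr_ge0 => i _; exact: marginal_ge0. Qed.

Lemma sum_product_mass : \sum_x mu x = 1.
Proof.
rewrite /product_mass -(bigA_distr_bigA (marginal theta)).
by apply: big1 => i _; exact: sum_marginal.
Qed.

Lemma product_mass_splice V x y :
  mu (splice V x y) * mu (splice V y x) = mu x * mu y.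
Proof.
rewrite /product_mass -!big_split; apply: eq_bigr => i _ /=.
rewrite !ffunE; case: ifP => _ //; exact: mulrC.
Qed.

Lemma spliceK V (x y : assignment n) : splice V (splice V x y) (splice V y x) = x.
Proof. by apply/ffunP => i; rewrite !ffunE; case: (i \in V). Qed.

(* Exchanging the coordinates outside [V] between the old assignment and the
   fresh one preserves the joint law and turns the resampled assignment into
   the second component. *)
Lemma resampled_mass (V : {set 'I_n}) (a b : pred (assignment n)) y :
  (forall x u, a (splice V x u) = a x) -> (forall x u, b (splice V u x) = b x) ->
  \sum_(x | a x && b x) \sum_(u | splice V u x == y) mu x * mu u
    = (\sum_(x | a x) mu x) * (if b y then mu y else 0).
Proof.
move=> aV bV; rewrite pair_big_dep /=.
pose h (z : assignment n * assignment n) := (splice V z.1 z.2, splice V z.2 z.1).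
have hK : involutive h by case=> x u; rewrite /h /= !spliceK.
rewrite (reindex_inj (inv_inj hK)) /=.
under eq_bigl => z do rewrite aV bV spliceK.
under eq_bigr => z _ do rewrite product_mass_splice.
rewrite (eq_bigl (fun z => a z.1 && (b z.2 && (z.2 == y)))); last first.
  by move=> z; rewrite andbA.
rewrite -(pair_big_dep a (fun _ u => b u && (u == y)) (fun x u => mu x * mu u)) /=.
rewrite mulr_suml; apply: eq_bigr => x _; rewrite -mulr_sumr; congr (_ * _).
rewrite big_mkcondl -big_mkcondr /= (eq_bigl (fun u => (u == y) && b u)).
  by rewrite big_mkcondr big_pred1_eq.
by move=> u; rewrite andbC.
Qed.

(** Sum [resampled_mass] over [y]: on the left the fresh draw contributes total mass 1. *)
Lemma splice_indep (V : {set 'I_n}) (a b : pred (assignment n)) :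
  (forall x u, a (splice V x u) = a x) -> (forall x u, b (splice V u x) = b x) ->
  \sum_(x | a x && b x) mu x = (\sum_(x | a x) mu x) * (\sum_(x | b x) mu x).
Proof.
move=> aV bV; rewrite [X in _ * X]big_mkcond mulr_sumr /=.
under [RHS]eq_bigr => y _ do rewrite -(resampled_mass y aV bV).
rewrite exchange_big /=; apply: eq_bigr => x _.
rewrite -[LHS]mulr1 -sum_product_mass mulr_sumr.
by rewrite (partition_big (fun u => splice V u x) predT).
Qed.

End ProductMass.

(** * Neighbourhoods of violated sets under extremality *)

Section Reach.
Import boot.finset.
Variables (n L : nat) (C : 'I_L -> constraint n).
Local Notation viol := (violated C).

(** The [N(S)] of the header. *)
Definition reach (S : {set 'I_L}) : {set 'I_L} :=
  S :|: [set j | ~~ [disjoint vars (C j) & vars_of C S]]%SET.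

Lemma reach0 : reach finset.set0 = finset.set0.
Proof.
apply/setP => j; rewrite !inE /vars_of big_set0 /=.
by rewrite (eq_disjoint_r (B := pred0)) ?disjoint0 // => [|i];
  rewrite ?inE // disjoint_sym disjoint0.
Qed.

(** Extremality forbids two distinct violated constraints from sharing a variable. *)
Lemma violated_reach (S : {set 'I_L}) x : extremal C ->
  S \subset viol x -> viol x :&: reach S = S.
Proof.
move=> ext Sx; apply/setP => j; apply/idP/idP; last first.
  move=> jS; rewrite !inE jS andbT.
  by move/fintype.subsetP: Sx => /(_ _ jS); rewrite inE.
rewrite !inE => /andP[jx /orP[//|]].
case/pred0Pn => v /= /andP[vj /bigcupP[i iS vi]].
have [->//|ij] := eqVneq j i.
move/fintype.subsetP: Sx => /(_ _ iS); rewrite inE => ix.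
case: (ext _ _ ij) => [/setP/(_ v)|/(_ x)]; first by rewrite !inE vj vi.
by rewrite (negbTE jx) (negbTE ix) => -[].
Qed.

Lemma subset_violated_splice (S : {set 'I_L}) x u :
  (S \subset viol (splice (vars_of C S) x u)) = (S \subset viol x).
Proof.
apply/fintype.subsetP/fintype.subsetP => H j jS; move: (H j jS); rewrite !inE;
rewrite (@sat_vars _ (C j) _ x) // => i ij; rewrite ffunE ifT //;
by apply/bigcupP; exists j.
Qed.

Lemma violated_splice_far (S : {set 'I_L}) x u :
  viol (splice (vars_of C S) u x) :\: reach S = viol x :\: reach S.
Proof.
apply/setP => j; rewrite !inE; case: (j \in S) => //=.
case: (boolP [disjoint _ & _]) => //= dj.
rewrite (@sat_vars _ (C j) _ x) // => i ij; rewrite ffunE ifF //.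
by apply/negbTE; move/pred0P: dj => /(_ i) /=; rewrite ij /= => ->.
Qed.

Lemma violated_eqU (S B : {set 'I_L}) x : extremal C -> [disjoint B & reach S] ->
  (viol x == S :|: B) = (S \subset viol x) && (viol x :\: reach S == B).
Proof.
move=> ext dB; apply/eqP/andP => [E|[Sx /eqP E]]; last first.
  by rewrite -(setID (viol x) (reach S)) E violated_reach.
have Sx : S \subset viol x by rewrite E subsetUl.
split=> //; rewrite E setDUl.
have /eqP -> : S :\: reach S == finset.set0 by rewrite setD_eq0 subsetUl.
by rewrite set0U; apply/eqP/setDidPl.
Qed.

End Reach.

(** * The one-step equation for the potential *)

Section Potential.
Import boot.finset numFieldNormedType.Exports.
Variables (R : realType) (n L : nat) (C : 'I_L -> constraint n).
Variable theta : 'I_n -> R.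
Hypothesis ext : extremal C.
Local Notation mu := (product_mass theta).
Local Notation viol := (violated C).
Local Notation q := (q theta C).

(** The [p_S] of the header; [Z(W)] is [qout W finset.set0], and [excess W] is the sum subtracted in
    [G(W)]. *)
Definition pviol (S : {set 'I_L}) : R := \sum_(x | S \subset viol x) mu x.

Definition qout (W B : {set 'I_L}) : R := \sum_(x | viol x :\: W == B) mu x.

Definition excess (W : {set 'I_L}) : R := \sum_(j | j \notin W) qout W [set j].

Lemma qout_ge0 W B : 0 <= qout W B.
Proof. by apply: sumr_ge0 => x _; exact: product_mass_ge0. Qed.

Lemma qout_le1 W B : qout W B <= 1.
Proof.
rewrite -(sum_product_mass theta) [leRHS](bigID (fun x => viol x :\: W == B)) /=.
by rewrite lerDl; apply: sumr_ge0 => x _; exact: product_mass_ge0.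
Qed.

Lemma q_ge0 S : 0 <= q S.
Proof. by apply: sumr_ge0 => x _; exact: product_mass_ge0. Qed.

Lemma pviol_ge0 S : 0 <= pviol S.
Proof. by apply: sumr_ge0 => x _; exact: product_mass_ge0. Qed.

(** Violation of [S] reads only [vars_of C S], while constraints outside [reach C S] read only the
    other coordinates. *)
Lemma q_setU (S B : {set 'I_L}) : [disjoint B & reach C S] ->
  q (S :|: B) = pviol S * qout (reach C S) B.
Proof.
move=> dB; rewrite /q (eq_bigl _ _ (fun x => violated_eqU x ext dB)).
apply: (@splice_indep _ _ theta (vars_of C S) (fun x => S \subset viol x)
  (fun x => viol x :\: reach C S == B)) => x u.
  exact: subset_violated_splice.
by rewrite violated_splice_far.
Qed.

Lemma q_factor S : q S = pviol S * qout (reach C S) finset.set0.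
Proof. by rewrite -q_setU ?setU0 // -setI_eq0 set0I. Qed.

Lemma qout_sum (W B : {set 'I_L}) : [disjoint B & W] ->
  qout W B = \sum_(S : {set 'I_L} | S \subset W) q (S :|: B).
Proof.
move=> dB; rewrite /qout.
rewrite (partition_big (fun x => viol x :&: W) (fun S => S \subset W)) => [|x _];
  last exact: subsetIr.
apply: eq_bigr => S SW; apply: eq_bigl => x.
apply/andP/eqP => [[/eqP <- /eqP <-]|->]; first by rewrite setID.
have := dB; rewrite -setI_eq0 => /eqP BW.
have /eqP SD : S :\: W == finset.set0 by rewrite setD_eq0.
by rewrite setDUl setIUl BW SD setU0 set0U (setIidPl SW) (setDidPl dB).
Qed.

Lemma q_setU1_reach (S : {set 'I_L}) j :
  j \in reach C S -> j \notin S -> q (j |: S)%SET = 0.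
Proof.
move=> jS /negP njS; apply: big_pred0 => x; apply/negP => /eqP vx.
have Sx : S \subset viol x by rewrite vx subsetUr.
by apply: njS; rewrite -(violated_reach ext Sx) in_setI jS andbT vx setU11.
Qed.

(** Terms with [j] outside [reach C S] factor by [q_setU]; those inside vanish by extremality. *)
Lemma pviol_excess S :
  pviol S * excess (reach C S) = \sum_(j | j \notin S) q (j |: S)%SET.
Proof.
rewrite mulr_sumr [RHS](bigID (mem (reach C S))) /= [X in _ = X + _]big1 ?add0r;
  last first.
  by move=> j /andP[jS jR]; exact: q_setU1_reach.
rewrite [RHS](eq_bigl (fun j => j \notin reach C S)) => [|j]; last first.
  rewrite andb_idl //; apply: contraNN => jS; by rewrite in_setU jS.
apply: eq_bigr => j jR; rewrite setUC q_setU //.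
by rewrite disjoints1.
Qed.

(** Split the right side by [j]: indices outside [W] give [excess W]; for [j] in [W], the set
    [j |: S] is a subset of [W] with a marked element, hence the factor [#|S|]. *)
Lemma excess_balance (W : {set 'I_L}) :
  excess W + \sum_(S : {set 'I_L} | S \subset W) q S * #|S|%:R
  = \sum_(S : {set 'I_L} | S \subset W) \sum_(j | j \notin S) q (j |: S)%SET.
Proof.
transitivity (\sum_(S : {set 'I_L} | S \subset W)
  (\sum_(j | j \notin W) q (j |: S)%SET
   + \sum_(j | (j \in W) && (j \notin S)) q (j |: S)%SET)); last first.
  apply: eq_bigr => S SW; rewrite [RHS](bigID (mem W)) /= addrC; congr (_ + _).
    apply: eq_bigl => j; rewrite andb_idl //; apply: contraNN.
    by move/fintype.subsetP: SW; exact.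
  by apply: eq_bigl => j; rewrite andbC.
rewrite big_split /=; congr (_ + _).
  rewrite exchange_big /=; apply: eq_bigr => j jW; rewrite qout_sum ?disjoints1 //.
  by apply: eq_bigr => S _; rewrite setUC.
transitivity (\sum_(j | j \in W)
  \sum_(S : {set 'I_L} | (S \subset W) && (j \in S)) q S).
  rewrite [RHS](exchange_big_dep (fun S : {set 'I_L} => S \subset W)) /=;
    last by move=> j S _ /andP[].
  apply: eq_bigr => S SW; rewrite (eq_bigl (fun j => j \in S)) => [|j].
    by rewrite sumr_const mulr_natr.
  by rewrite SW /= andb_idl //; move/fintype.subsetP: SW; exact.
rewrite [RHS](exchange_big_dep (fun j => j \in W)) /=; last by move=> S j _ /andP[].
apply: eq_bigr => j jW.
rewrite (reindex_onto (fun S => j |: S)%SET (fun S => S :\ j)%SET)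
  => [|S /andP[_ jS]]; last first.
  by rewrite finset.setD1K.
apply: eq_bigl => S; rewrite subUset sub1set jW setU11 andbT /= ; congr (_ && _).
apply/eqP/idP => [<-|jS]; first by rewrite setD11.
by rewrite setU1K.
Qed.

(* The value [G(W)] of the header; [c] is kept free until [G] has to vanish at
   the empty set. *)
Definition potential c (W : {set 'I_L}) : R := c * qout W finset.set0 - excess W.

(** By [q_factor] the terms in [c] add up to [c * qout W finset.set0]; [excess_balance] settles the
    rest, for every [c]. *)
Lemma potentialE c W : potential c W =
  \sum_(S : {set 'I_L} | S \subset W)
    (q S * #|S|%:R + pviol S * potential c (reach C S)).
Proof.
rewrite big_split /=; under [X in _ + X]eq_bigr => S _ do
  rewrite /potential mulrBr pviol_excess mulrCA -q_factor.
rewrite big_split /= sumrN -mulr_sumr -excess_balance /potential qout_sum; last first.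
  by rewrite -setI_eq0 set0I.
under [X in c * X - _ = _]eq_bigr => S _ do rewrite setU0.
ring.
Qed.

(** * Law of the current assignment and telescoping *)

Fixpoint law t (y : assignment n) : R :=
  if t is t'.+1 then \sum_x \sum_(u | resample C u x == y) law t' x * mu u
  else mu y.

(* Density of the law of round [t] with respect to the initial law: it depends
   on an assignment only through its violated set. *)
Fixpoint density t (S : {set 'I_L}) : R :=
  if t is t'.+1 then
    \sum_(S' : {set 'I_L} | S \subset reach C S') density t' S' * pviol S'
  else 1.

(** On each class of assignments with violated set [S] the old density is constant, and
    [resampled_mass] returns [mu] restricted to violated sets inside [reach C S], with weight
    [pviol S]. *)
Lemma lawE t y : law t y = density t (viol y) * mu y.
Proof.
elim: t y => [|t IH] y /=; first by rewrite mul1r.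
rewrite (partition_big viol predT) //= mulr_suml [RHS]big_mkcond.
apply: eq_bigr => S _.
transitivity (density t S *
  \sum_(x | (S \subset viol x) && (viol x :\: reach C S == finset.set0))
   \sum_(u | splice (vars_of C S) u x == y) mu x * mu u).
  rewrite mulr_sumr; apply: eq_big => [x|x /eqP vx].
    by rewrite -violated_eqU ?setU0 // -setI_eq0 set0I.
  rewrite mulr_sumr /resample vx; apply: eq_bigr => u _; by rewrite IH vx mulrA.
rewrite (@resampled_mass _ _ theta (vars_of C S) (fun x => S \subset viol x)
  (fun x => viol x :\: reach C S == finset.set0)) => [|x u|x u].
- rewrite setD_eq0 -/(pviol S); case: ifP => _; by rewrite ?mulr0 // mulrA.
- exact: subset_violated_splice.
- by rewrite violated_splice_far.
Qed.

Lemma density_ge0 t S : 0 <= density t S.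
Proof.
elim: t S => [|t IH] S //=; apply: sumr_ge0 => S' _.
by rewrite mulr_ge0 ?pviol_ge0.
Qed.

Lemma sum_law t : \sum_y law t y = 1.
Proof.
elim: t => [|t IH] /=; first exact: sum_product_mass.
rewrite exchange_big -IH /=; apply: eq_bigr => x _.
rewrite -[RHS]mulr1 -(sum_product_mass theta) mulr_sumr.
by rewrite [RHS](partition_big (fun u => resample C u x) predT).
Qed.

Definition mean_violated t : R := \sum_x law t x * #|viol x|%:R.

Lemma mean_violatedE t : mean_violated t = \sum_S density t S * (q S * #|S|%:R).
Proof.
rewrite /mean_violated (partition_big viol predT) //=; apply: eq_bigr => S _.
rewrite mulr_suml mulr_sumr; apply: eq_bigr => x /eqP vx.
by rewrite lawE vx mulrA.
Qed.

Lemma law_ge0 t x : 0 <= law t x.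
Proof. by rewrite lawE mulr_ge0 ?density_ge0 ?product_mass_ge0. Qed.

Lemma mean_violated_ge0 t : 0 <= mean_violated t.
Proof. by apply: sumr_ge0 => x _; rewrite mulr_ge0 ?law_ge0. Qed.

Lemma mean_violated_le t : mean_violated t <= L%:R.
Proof.
rewrite -[leRHS]mul1r -[X in X * _](sum_law t) mulr_suml; apply: ler_sum => x _.
by rewrite ler_wpM2l ?law_ge0 // ler_nat (leq_trans (max_card _)) ?card_ord.
Qed.

(** What the potential predicts for the rounds after [t]. *)
Definition remainder c t : R :=
  \sum_S density t S * (pviol S * potential c (reach C S)).

Lemma remainderS c t : remainder c t = mean_violated t.+1 + remainder c t.+1.
Proof.
rewrite mean_violatedE /remainder -big_split /=.
under [RHS]eq_bigr => S _ do rewrite -mulrDr mulr_suml.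
rewrite [RHS](exchange_big_dep predT) //=; apply: eq_bigr => S _.
by rewrite mulrA -mulr_sumr -potentialE.
Qed.

Lemma potential_setT c : potential c finset.setT = c.
Proof.
rewrite /potential /excess big1 ?subr0 => [|j]; last by rewrite inE.
rewrite /qout (eq_bigl predT) ?sum_product_mass ?mulr1 // => x.
by rewrite setDT eqxx.
Qed.

Lemma partial_sums c N : \sum_(0 <= t < N.+1) mean_violated t = c - remainder c N.
Proof.
elim: N => [|N IH]; last by rewrite big_nat_recr //= IH remainderS; ring.
(* The initial law is unconditioned, so round 0 is the one-step equation at the full set. *)
rewrite big_nat1 mean_violatedE /remainder /= -{1}(potential_setT c) potentialE.
rewrite big_split /= !(eq_bigl predT _ (@subsetT _)).
under [X in _ = _ - X]eq_bigr do rewrite mul1r.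
under eq_bigr do rewrite mul1r.
ring.
Qed.

(** * Vanishing of the remainder *)

Hypothesis q0_gt0 : 0 < q finset.set0.

Definition expected_total : R := (q finset.set0)^-1 * \sum_(j < L) q [set j].

Local Notation bound := (expected_total + L%:R / q finset.set0).

Lemma expected_total_ge0 : 0 <= expected_total.
Proof. by rewrite mulr_ge0 ?invr_ge0 ?q_ge0 // sumr_ge0 // => j _; exact: q_ge0. Qed.

Lemma potential_set0 : potential expected_total finset.set0 = 0.
Proof.
have E B : qout finset.set0 B = q B by apply: eq_bigl => x; rewrite setD0.
rewrite /potential /excess E /expected_total mulrAC mulVf ?gt_eqF // mul1r.
by under [X in _ - X]eq_bigr do rewrite E;
  rewrite (eq_bigl predT) ?subrr // => j; rewrite inE.
Qed.

Lemma q0_le_qout W : q finset.set0 <= qout W finset.set0.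
Proof.
rewrite qout_sum; last by rewrite -setI_eq0 set0I.
rewrite (bigD1 finset.set0) ?sub0set //= setU0 lerDl.
by apply: sumr_ge0 => S _; exact: q_ge0.
Qed.

Lemma potential_bound W :
  `|potential expected_total W| <= bound * qout W finset.set0.
Proof.
have c0 := expected_total_ge0.
have e0 : 0 <= excess W by apply: sumr_ge0 => j _; exact: qout_ge0.
have eL : excess W <= L%:R.
  apply: (@le_trans _ _ (\sum_(j | j \notin W) 1)).
    by apply: ler_sum => j _; exact: qout_le1.
  by rewrite sumr_const ler_nat (leq_trans (max_card _)) ?card_ord.
have qL : L%:R <= L%:R / q finset.set0 * qout W finset.set0.
  by rewrite -mulrA ler_peMr // mulrC ler_pdivlMr // mul1r q0_le_qout.
have cq : 0 <= expected_total * qout W finset.set0 by rewrite mulr_ge0 ?qout_ge0.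
rewrite /potential mulrDl ler_norml; apply/andP; split; lra.
Qed.

Lemma remainder_bound t :
  `|remainder expected_total t| <= bound * mean_violated t.
Proof.
rewrite mean_violatedE mulr_sumr; apply: le_trans (ler_norm_sum _ _ _) _.
apply: ler_sum => S _; rewrite !normrM.
rewrite (ger0_norm (density_ge0 _ _)) (ger0_norm (pviol_ge0 _)).
rewrite [leRHS]mulrCA ler_wpM2l ?density_ge0 //.
have b0 : 0 <= bound.
  by rewrite addr_ge0 ?expected_total_ge0 ?divr_ge0 // ltW.
(* The factor [#|S|] dominates 1 only for nonempty [S]; at the empty set the choice of [c] makes the
   potential vanish. *)
have [->|S0] := eqVneq S finset.set0.
  by rewrite reach0 potential_set0 normr0 mulr0 cards0 !mulr0.
apply: (@le_trans _ _ (bound * q S)).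
  by rewrite (q_factor S) [leRHS]mulrCA ler_wpM2l ?pviol_ge0 // potential_bound.
by rewrite ler_wpM2l // ler_peMr ?q_ge0 // ler1n card_gt0.
Qed.

Lemma cvg_mean_violated :
  (series mean_violated @ \oo --> expected_total)%classic.
Proof.
have b0 : 0 <= bound.
  by rewrite addr_ge0 ?expected_total_ge0 ?divr_ge0 // ltW.
have cv : cvgn (series mean_violated).
  apply: nondecreasing_is_cvgn.
    by apply: nondecreasing_series => k _ _; exact: mean_violated_ge0.
  (* The crude bound [mean_violated t <= L] already bounds the partial sums; convergence then sends
     the terms, and so the remainder, to 0. *)
  exists (expected_total + bound * L%:R) => _ [[|N] _ <-].
    by rewrite /series /= big_geq // addr_ge0 ?expected_total_ge0 ?mulr_ge0.
  rewrite /series /= (partial_sums expected_total) lerD2l.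
  apply: le_trans (ler_norm _) _; rewrite normrN.
  apply: le_trans (remainder_bound _) _.
  by rewrite ler_wpM2l // mean_violated_le.
have m0 := cvg_series_cvg_0 cv.
have r0 : (remainder expected_total @ \oo --> (0 : R))%classic.
  apply/norm_cvg0P.
  apply: (@squeeze_cvgr _ _ _ _ (fun=> 0) (fun t => bound * mean_violated t)).
  - by near=> t; rewrite normr_ge0 remainder_bound.
  - exact: cvg_cst.
  - by rewrite -[X in (_ --> X)%classic](mulr0 bound); apply: cvgMr.
rewrite -cvg_shiftS.
have -> : [sequence series mean_violated k.+1]_k
    = (fun k => expected_total - remainder expected_total k).
  by apply/funext => k; rewrite /series /= (partial_sums expected_total).
by have := cvgB (cvg_cst expected_total) r0; rewrite subr0; apply.
Unshelve. all: by end_near. Qed.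

Lemma nneseries_mean_violated :
  (\big[+%E/0%E]_(0 <= t <oo) (mean_violated t)%:E)%E = expected_total%:E.
Proof.
have cv := cvg_mean_violated.
rewrite -(cvg_lim (@norm_hausdorff _ _) cv) -EFin_lim; last exact: cvgP cv.
by congr (limn _)%classic; apply/funext => N /=; rewrite sumEFin.
Qed.

End Potential.

(** * From random draws to the law of the run *)

Section Runs.
Local Open Scope classical_set_scope.
Import numFieldNormedType.Exports.
Variables (R : realType) (n L : nat) (C : 'I_L -> constraint n).
Variables (theta : 'I_n -> R) (d : measure_display) (T : measurableType d).
Variables (P : probability T R) (U : nat -> 'I_n -> {RV P >-> bool}).
Hypothesis fresh : fresh_draws theta U.
Local Notation mu := (product_mass theta).

Lemma measurable_exists (I : finType) (p : pred I) (F : I -> set T) :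
  (forall i, measurable (F i)) ->
  measurable [set w | exists2 i, p i & F i w].
Proof.
move=> mF; rewrite (_ : mkset _ = \bigcup_(i in [set i | p i]) F i) //.
by apply: fin_bigcup_measurable => //; exact: finite_finset.
Qed.

Lemma prob_exists (I : finType) (p : pred I) (F : I -> set T) :
  (forall i, measurable (F i)) ->
  (forall i j w, F i w -> F j w -> i = j) ->
  P [set w | exists2 i, p i & F i w] = (\sum_(i | p i) P (F i))%E.
Proof.
move=> mF dF; rewrite (_ : mkset _ = \bigcup_(i in [set` enum p]) F i); last first.
  by apply/seteqP; split=> w [i pi Fi]; exists i => //; move: pi;
    rewrite /= mem_enum.
rewrite measure_fin_bigcup //.
- by rewrite -fsbig_seq ?enum_uniq // big_enum.
- by move=> i j _ _ [w [Fi Fj]]; exact: dF Fi Fj.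
Qed.

Fixpoint starts_with (u : nat -> assignment n) a (l : seq (assignment n)) : Prop :=
  if l is v :: l' then u a = v /\ starts_with u a.+1 l' else True.

Lemma starts_withP v0 u a l : starts_with u a l <->
  forall k, (k < size l)%N -> u (a + k)%N = nth v0 l k.
Proof.
elim: l a => [|v l IH] a; first by split.
split=> [[uv /IH ul] [|k] kl|ul].
- by rewrite addn0.
- by rewrite -addSnnS ul.
- split; first by have := ul 0%N isT; rewrite addn0.
  by apply/IH => k kl; rewrite addSnnS; exact: (ul k.+1).
Qed.

(** A finite intersection over distinct pairs (round, coordinate), the form that
    [mutually_independent] accepts. *)
Lemma starts_with_event v0 a l :
  [set w | starts_with (draw U w) a l]
  = \bigcap_(k in [set` [seq (a + t, i)%N | t <- iota 0 (size l), i <- enum 'I_n]])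
      U k.1 k.2 @^-1` [set nth v0 l (k.1 - a)%N k.2].
Proof.
apply/seteqP; split=> w.
  move/(starts_withP v0) => wl _ /allpairsP[[t i] [/= + _ ->]] /=.
  by rewrite mem_iota add0n => /wl/ffunP/(_ i); rewrite ffunE addKn.
move=> wl; apply/(starts_withP v0) => k kl; apply/ffunP => i; rewrite ffunE.
have := wl (a + k, i)%N; rewrite /= addKn; apply.
by apply/allpairsP; exists (k, i); rewrite mem_iota mem_enum.
Qed.

Lemma measurable_starts_with a l :
  measurable [set w | starts_with (draw U w) a l].
Proof.
rewrite (starts_with_event [ffun=> false]); apply: fin_bigcap_measurable => // k _.
by rewrite -[X in measurable X]setTI; exact: measurable_funPT.
Qed.

Lemma prob_starts_with a l :
  P [set w | starts_with (draw U w) a l] = (\prod_(v <- l) mu v)%:E.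
Proof.
have [indep marg] := fresh.
pose v0 : assignment n := [ffun=> false].
rewrite (starts_with_event v0).
rewrite (indep _ (fun k => [set nth v0 l (k.1 - a)%N k.2])) //; last first.
  apply: allpairs_uniq; rewrite ?iota_uniq ?enum_uniq //.
  by move=> [t i] [t' i'] _ _ /= [/addnI -> ->].
rewrite big_allpairs_dep /= (big_nth v0) -prodEFin /index_iota subn0.
apply: eq_bigr => t _; rewrite big_enum -prodEFin.
by apply: eq_bigr => i _; rewrite marg addKn.
Qed.

(* The future draws [l] are part of the event to make the induction on [t] go
   through without a general theory of independence. *)
Lemma current_event t x l :
  measurable [set w | current C (draw U w) t = x /\ starts_with (draw U w) t.+1 l]
  /\ P [set w | current C (draw U w) t = x /\ starts_with (draw U w) t.+1 l]
     = (law C theta t x * \prod_(v <- l) mu v)%:E.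
Proof.
elim: t x l => [|t IH] x l.
  rewrite (_ : mkset _ = [set w | starts_with (draw U w) 0 (x :: l)]) //.
  split; first exact: measurable_starts_with.
  by rewrite prob_starts_with big_cons.
pose F (z : assignment n * assignment n) :=
  [set w | current C (draw U w) t = z.1 /\ starts_with (draw U w) t.+1 (z.2 :: l)].
have mF z : measurable (F z) by have [] := IH z.1 (z.2 :: l).
(* Disjoint union over the assignment at round [t] and the next draw, which is prepended to the
   future draws. *)
have -> : [set w | current C (draw U w) t.+1 = x /\ starts_with (draw U w) t.+2 l]
    = [set w | exists2 z, resample C z.2 z.1 == x & F z w].
  apply/seteqP; split=> w /=.
    move=> [cx wl]; exists (current C (draw U w) t, draw U w t.+1) => //.
    exact/eqP.
  by move=> [[y u] /= /eqP <- [yE [uE wl]]]; rewrite yE uE.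
split; first exact: measurable_exists.
rewrite prob_exists //; last first.
  by move=> [y u] [y' u'] w [/= yE [uE _]] [/= <- [<- _]]; rewrite yE uE.
rewrite (eq_bigr (fun z =>
  (law C theta t z.1 * mu z.2 * \prod_(v <- l) mu v)%:E)); last first.
  by move=> z _; rewrite (IH z.1 (z.2 :: l)).2 big_cons mulrA.
rewrite sumEFin -mulr_suml; congr (_ * _)%:E.
by rewrite /= pair_big_dep.
Qed.

Lemma measurable_current t x : measurable [set w | current C (draw U w) t = x].
Proof.
have [+ _] := current_event t x [::].
by rewrite (_ : mkset _ = [set w | current C (draw U w) t = x]) //;
  apply/seteqP; split=> w // [].
Qed.

Lemma prob_current t x :
  P [set w | current C (draw U w) t = x] = (law C theta t x)%:E.
Proof.
have [_] := current_event t x [::]; rewrite big_nil mulr1 => <-.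
by congr (P _); apply/seteqP; split=> w // [].
Qed.

Lemma card_violatedE t w :
  (#|violated C (current C (draw U w) t)|%:R)%:E
  = (\sum_x (#|violated C x|%:R : R)%:E *
      (\1_[set w | current C (draw U w) t = x] w)%:E)%E.
Proof.
rewrite (bigD1 (current C (draw U w) t)) //= big1 ?adde0 => [|x /eqP xN].
  by rewrite indicE mem_set // mule1.
by rewrite indicE memNset ?mule0 // => E; exact: xN.
Qed.

Lemma measurable_card_violated t :
  measurable_fun [set: T]
    (fun w => (#|violated C (current C (draw U w) t)|%:R : R)%:E).
Proof.
under eq_fun do rewrite card_violatedE.
apply: emeasurable_sum => x.
apply: measurable_funeM; apply/measurable_EFinP.
by apply: measurable_indic; exact: measurable_current.
Qed.

Lemma integral_card_violated t :
  (\int[P]_w (#|violated C (current C (draw U w) t)|%:R : R)%:E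
   = (mean_violated C theta t)%:E)%E.
Proof.
under eq_integral do rewrite card_violatedE.
have mI x : measurable_fun [set: T]
    (fun w => (\1_[set w | current C (draw U w) t = x] w : R)%:E).
  by apply/measurable_EFinP; apply: measurable_indic; exact: measurable_current.
rewrite ge0_integral_sum //; last first.
  by move=> x; exact: measurable_funeM.
rewrite -sumEFin; apply: eq_bigr => x _.
rewrite ge0_integralZl // integral_indic //; last exact: measurable_current.
by rewrite setIT EFinM -prob_current muleC.
Qed.

End Runs.

Theorem theorem2 (R : realType) (n L : nat) (C : 'I_L -> constraint n)
    (theta : 'I_n -> R)
    (d : measure_display) (T : measurableType d) (P : probability T R)
    (U : nat -> 'I_n -> {RV P >-> bool}) :
  extremal C ->
  0 < q theta C finset.set0 ->
  fresh_draws theta U ->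
  (\int[P]_w \sum_(j < L) num_resamplings C R (draw U w) j
    = ((q theta C finset.set0)^-1 * \sum_(j < L) q theta C [set j]%SET)%R%:E)%E.
Proof.
move=> ext q0 fresh.
(* Counting by rounds instead of by constraints; nonnegativity allows both this exchange and the
   later one with the integral. *)
have totalE w : (\sum_(j < L) num_resamplings C R (draw U w) j
    = \big[+%E/0%E]_(0 <= t <oo)
        (#|violated C (current C (draw U w) t)|%:R : R)%:E)%E.
  rewrite -nneseries_sum => [|j t _]; last by rewrite lee_fin.
  apply: eq_eseriesr => t _; rewrite sumEFin -sum1_card natr_sum.
  by rewrite [in RHS]big_mkcond; congr _%:E; apply: eq_bigr => j _; case: ifP.
under eq_integral do rewrite totalE.
rewrite integral_nneseries //; last first.
  by move=> t; exact: measurable_card_violated fresh t.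
under eq_eseriesr => t _ do rewrite (integral_card_violated C fresh).
exact: nneseries_mean_violated.
Qed.
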